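(* Let $X$ be a compact Hausdorff space, and let $A\subseteq\mathrm{C}(X)$ be a $\delta$-subalgebra of $\mathrm{C}(X)$ that separates the points of $X$ (for all $x\ne y$ in $X$ there is $f\in A$ with $f(x)\ne f(y)$). Then $A=\mathrm{C}(X)$.
   Context: $\mathrm{C}(X)$ denotes the set of continuous functions $X\to[0,1]$, with pointwise operations $f\oplus g=\min\{f+g,1\}$, $\neg f=1-f$, $0$ the constant zero function, and with the infinitary operation $\delta(g_1,g_2,\ldots)=\sum_{i=1}^\infty g_i/2^i$ (for $X=\emptyset$, $\mathrm{C}(X)$ is a singleton). A $\delta$-subalgebra is a subset containing $0$ and closed under $\oplus$, $\neg$ and $\delta$. *)

(* Defs.v *)
From HB Require Import structures.
From mathcomp Require Import all_boot all_order all_algebra.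
From mathcomp Require Import all_classical all_reals all_analysis.
Import Order.TTheory GRing.Theory Num.Theory.
Import numFieldNormedType.Exports.

Set Implicit Arguments.
Unset Strict Implicit.
Unset Printing Implicit Defensive.

Local Open Scope classical_set_scope.
Local Open Scope ring_scope.

(* C(X), represented as a set of real-valued functions; for empty X it is a
   singleton by functional extensionality. *)
Definition CX (R : realType) (X : topologicalType) : set (X -> R) :=
  [set f : X -> R | continuous f /\ forall x, 0 <= f x <= 1].
Arguments CX : clear implicits.

Definition mv_zero (R : realType) (X : Type) : X -> R := fun=> 0.
Arguments mv_zero : clear implicits.

Definition mv_oplus (R : realType) (X : Type) (f g : X -> R) : X -> R :=
  fun x => Num.min (f x + g x) 1.

Definition mv_neg (R : realType) (X : Type) (f : X -> R) : X -> R :=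
  fun x => 1 - f x.

(* Sequences are indexed from 0, so that [g i] is the paper's g_(i+1), with
   weight 1/2^(i+1).  The series converges whenever the [g i] take values in
   [0, 1]. *)
Definition mv_delta (R : realType) (X : Type) (g : nat -> X -> R) : X -> R :=
  fun x => \big[+%R/0]_(0 <= i <oo) (g i x / 2 ^+ i.+1).

Record delta_subalgebra (R : realType) (X : topologicalType)
    (A : set (X -> R)) : Prop := DeltaSubalgebra {
  delta_subalgebra_sub : A `<=` CX R X;
  delta_subalgebra0 : A (mv_zero R X);
  delta_subalgebra_oplus : forall f g, A f -> A g -> A (mv_oplus f g);
  delta_subalgebra_neg : forall f, A f -> A (mv_neg f);
  delta_subalgebra_delta :
    forall g : nat -> X -> R, (forall i, A (g i)) -> A (mv_delta g)
}.

Definition separates (R : realType) (X : Type) (A : set (X -> R)) : Prop :=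
  forall x y : X, x <> y -> exists2 f, A f & f x <> f y.

(* Main.v *)
Require Import Defs.
From mathcomp Require Import all_boot all_order all_algebra.
From mathcomp Require Import all_classical all_reals all_analysis.
From mathcomp Require Import ring lra.
Import Order.TTheory GRing.Theory Num.Theory.
Import numFieldNormedType.Exports.

Local Open Scope classical_set_scope.
Local Open Scope ring_scope.

(** If every [f] in [C(X)] admits some [g] in [A] with [2 f - g] again in
    [C(X)], then iterating [f |-> 2 f - g] expands [f] as [delta(g_1, g_2, ...)],
    so [f] is in [A].  Such a [g] is the average of two functions of [A] that
    separate [f <= 1/4] from [f >= 1/2] and [f <= 1/2] from [f >= 3/4].
    Functions of [A] separating disjoint closed sets are obtained from the
    separation of points by truncated addition and compactness. *)

(** Telescoping: the recurrence turns each term [g i / 2 ^+ i.+1] into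
    [f i / 2 ^+ i - f i.+1 / 2 ^+ i.+1]. *)
Lemma delta_partial_sum (R : realType) (f g : nat -> R) :
  (forall n, f n.+1 = 2 * f n - g n) ->
  forall n, \sum_(0 <= i < n) g i / 2 ^+ i.+1 = f 0%N - f n / 2 ^+ n.
Proof.
move=> fS; elim=> [|n IHn]; first by rewrite big_nil expr0 divr1 subrr.
rewrite big_nat_recr //= IHn fS exprS.
have ? : (2 : R) ^+ n != 0 by rewrite expf_neq0// pnatr_eq0.
by field.
Qed.

Lemma delta_expansion (R : realType) (f g : nat -> R) :
  (forall n, 0 <= f n <= 1) -> (forall n, f n.+1 = 2 * f n - g n) ->
  \big[+%R/0]_(0 <= i <oo) (g i / 2 ^+ i.+1) = f 0%N.
Proof.
move=> f01 fS; apply: cvg_lim => //.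
rewrite (_ : (fun n => _) = fun n => f 0%N - f n / 2 ^+ n); last first.
  by apply/funext => n; exact: delta_partial_sum.
rewrite -[X in _ --> X]subr0; apply: cvgB; first exact: cvg_cst.
(* Since [f n] stays in [0, 1], the remainder is at most [2^-1 ^+ n]. *)
apply: (@squeeze_cvgr _ _ _ _ (fun=> 0) (fun n => 2^-1 ^+ n)).
- apply: nearW => n; have /andP[f0 f1] := f01 n.
  by rewrite divr_ge0 ?exprn_ge0//= exprVn ler_piMl// invr_ge0 exprn_ge0.
- exact: cvg_cst.
- by apply: cvg_expr; rewrite ger0_norm ?invr_ge0// invf_lt1 ?ltr1n.
Qed.

(* Coinduction: [P] only has to be stable under [f |-> 2 f - g]. *)
Lemma delta_subalgebra_coind (R : realType) (X : topologicalType)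
    (A P : set (X -> R)) : delta_subalgebra A ->
  (forall f, P f -> forall x, 0 <= f x <= 1) ->
  (forall f, P f -> exists2 g, A g & P (fun x => 2 * f x - g x)) ->
  P `<=` A.
Proof.
move=> A_sub P01 Pstep f Pf.
have [d dP] : {d : (X -> R) -> X -> R & forall f, P f ->
    A (d f) /\ P (fun x => 2 * f x - d f x)}.
  (* Choice needs a total relation, so outside [P] an arbitrary value is supplied, here [h]
     itself. *)
  apply: (@choice _ _ (fun f g => P f -> A g /\ P (fun x => 2 * f x - g x))).
  move=> h; have [Ph|nPh] := pselect (P h); last by exists h.
  by have [g Ag Pg] := Pstep _ Ph; exists g.
pose F n := iter n (fun h x => 2 * h x - d h x) f.
have PF n : P (F n) by elim: n => [//|n IHn]; have [] := dP _ IHn.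
rewrite (_ : f = mv_delta (fun n => d (F n))).
  by apply: (delta_subalgebra_delta A_sub) => n; have [] := dP _ (PF n).
apply/funext => x; rewrite /mv_delta (@delta_expansion _ (F ^~ x))// => n.
exact: P01.
Qed.

Lemma delta_subalgebra_01 (R : realType) (X : topologicalType)
    (A : set (X -> R)) : delta_subalgebra A ->
  forall f, A f -> forall x, 0 <= f x <= 1.
Proof. by move=> A_sub f /(delta_subalgebra_sub A_sub)[]. Qed.

(** Binary expansion of [c]: each digit is the constant 0 or 1, and the remainder [2 a] or [2 a - 1]
    is again a constant in [0, 1]. *)
Lemma delta_subalgebra_cst (R : realType) (X : topologicalType)
    (A : set (X -> R)) (c : R) : delta_subalgebra A -> 0 <= c <= 1 ->
  A (fun=> c).
Proof.
move=> A_sub c01.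
apply: (@delta_subalgebra_coind _ _ A
  [set f | exists2 c, 0 <= c <= 1 & f = fun=> c]) => //=; last by exists c.
  by move=> _ [a a01 ->].
move=> _ [a a01 ->]; have [a2|a2] := leP a (1/2).
  exists (mv_zero R X); first exact: delta_subalgebra0.
  by exists (2 * a); [lra | apply/funext => x; rewrite /mv_zero subr0].
exists (mv_neg (mv_zero R X)).
  by apply: delta_subalgebra_neg => //; exact: delta_subalgebra0.
exists (2 * a - 1); first lra.
by apply/funext => x; rewrite /mv_neg /mv_zero subr0.
Qed.

(** The average is delta(f, g, g, ...): removing the digit [u] from [(u + v) / 2] leaves [v], which
    is the average of [v] with itself. *)
Lemma delta_subalgebra_avg (R : realType) (X : topologicalType)
    (A : set (X -> R)) (f g : X -> R) : delta_subalgebra A -> A f -> A g ->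
  A (fun x => (f x + g x) / 2).
Proof.
move=> A_sub Af Ag.
apply: (@delta_subalgebra_coind _ _ A [set h | exists u v,
  [/\ A u, A v & h = fun x => (u x + v x) / 2]]) => //=; last by exists f, g.
  move=> _ [u [v [Au Av ->]]] x.
  have := delta_subalgebra_01 _ _ _ A_sub _ Au x.
  by have := delta_subalgebra_01 _ _ _ A_sub _ Av x; lra.
move=> _ [u [v [Au Av ->]]]; exists u => //; exists v, v; split=> //.
by apply/funext => x; field.
Qed.

Lemma delta_subalgebra_muln (R : realType) (X : topologicalType)
    (A : set (X -> R)) (f : X -> R) (n : nat) : delta_subalgebra A -> A f ->
  A (fun x => Num.min (n%:R * f x) 1).
Proof.
move=> A_sub Af; elim: n => [|n IHn].
  rewrite (_ : (fun x => _) = mv_zero R X); first exact: delta_subalgebra0.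
  by apply/funext => x; rewrite mul0r min_l.
rewrite (_ : (fun x => _) =
    mv_oplus (fun x => Num.min (n%:R * f x) 1) f).
  exact: delta_subalgebra_oplus.
apply/funext => x; rewrite /mv_oplus -natr1 mulrDl mul1r.
have /andP[f0 _] := delta_subalgebra_01 _ _ _ A_sub _ Af x.
(* Truncating early is harmless: as [f x >= 0], a multiple that has passed 1 stays above it. *)
by have [//|ft] := leP (n%:R * f x) 1; rewrite !min_r; lra.
Qed.

Lemma delta_subalgebra_subcst (R : realType) (X : topologicalType)
    (A : set (X -> R)) (f : X -> R) (c : R) : delta_subalgebra A -> A f ->
  0 <= c <= 1 -> A (fun x => Num.max (f x - c) 0).
Proof.
move=> A_sub Af c01.
rewrite (_ : (fun x => _) = mv_neg (mv_oplus (mv_neg f) (fun=> c))).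
  apply: delta_subalgebra_neg => //; apply: delta_subalgebra_oplus => //.
    exact: delta_subalgebra_neg.
  exact: delta_subalgebra_cst.
apply/funext => x; rewrite /mv_neg /mv_oplus.
by have [?|?] := leP (f x - c) 0; have [?|?] := leP (1 - f x + c) 1; lra.
Qed.

Lemma delta_subalgebra_sep_nbhs (R : realType) (X : topologicalType)
    (A : set (X -> R)) (f : X -> R) (x y : X) : delta_subalgebra A -> A f ->
  f x < f y ->
  exists h, [/\ A h, \forall z \near x, h z = 0 & \forall z \near y, h z = 1].
Proof.
move=> A_sub Af fxy.
have f01 := delta_subalgebra_01 _ _ _ A_sub _ Af.
have [fc _] := delta_subalgebra_sub A_sub Af.
(* Cutting [f x, f y] into thirds leaves room for continuity: [f < c] near [x] and [f > d] near [y].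
   The truncated difference of [f] and [c] then vanishes near [x] and exceeds [d - c] near [y],
   where a large multiple reaches 1. *)
pose c := (2 * f x + f y) / 3; pose d := (f x + 2 * f y) / 3.
have cd : 0 < d - c by rewrite /c /d; lra.
pose n := (Num.truncn (d - c)^-1).+1.
have nP : 1 <= n%:R * (d - c).
  by rewrite -ler_pdivrMr// div1r ltW// truncnS_gt.
exists (fun z => Num.min (n%:R * Num.max (f z - c) 0) 1); split.
- apply: delta_subalgebra_muln => //; apply: delta_subalgebra_subcst => //.
  by have := f01 x; have := f01 y; rewrite /c; lra.
- have xc : f x < c by rewrite /c; lra.
  near=> z; have zc : f z < c by near: z; exact: cvgr_lt (fc x) _ xc.
  by rewrite max_r ?mulr0 ?min_l//; lra.
- have yd : d < f y by rewrite /d; lra.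
  near=> z; have zd : d < f z by near: z; exact: cvgr_gt (fc y) _ yd.
  rewrite max_l; last by lra.
  by rewrite min_r// (le_trans nP)// ler_wpM2l//; lra.
Unshelve. all: by end_near. Qed.

(** The filter [F] is kept general to serve twice in the Urysohn argument: as the neighbourhoods of
    a point, then as the supersets of a compact set. *)
Lemma delta_subalgebra_sep_compact (R : realType) (X : topologicalType)
    (A : set (X -> R)) (K : set X) (F : set_system X) {FF : Filter F} :
  delta_subalgebra A -> compact K ->
  (forall y, K y -> exists h,
    [/\ A h, \forall z \near F, h z = 0 & \forall z \near y, h z = 1]) ->
  exists h, [/\ A h, \forall z \near F, h z = 0 & forall z, K z -> h z = 1].
Proof.
move=> A_sub /compact_near_coveringP Kc Kh.
pose H := [set h | A h /\ \forall z \near F, h z = 0].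
have H0 : H (mv_zero R X).
  by split; [exact: delta_subalgebra0 | exact: nearW].
have HD u v : H u -> H v -> H (mv_oplus u v).
  move=> [Au u0] [Av v0]; split; first exact: delta_subalgebra_oplus.
  by near=> z; rewrite /mv_oplus (near u0 z)// (near v0 z)// addr0 min_l.
have H01 u : H u -> forall z, 0 <= u z <= 1.
  by move=> [Au _]; exact: delta_subalgebra_01 A_sub _ Au.
(* The filter of tails of [H], which is directed upwards by truncated sum. *)
pose T := [set B : set (X -> R) | exists2 h, H h &
  forall k, H k -> (forall z, h z <= k z) -> B k].
have TF : Filter T.
  split.
  - by exists (mv_zero R X).
  - move=> B C [u Hu uB] [v Hv vC]; exists (mv_oplus u v); first exact: HD.
    move=> k Hk uvk; split; [apply: uB => // z|apply: vC => // z];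
      apply: le_trans (uvk z); have := H01 _ Hu z; have := H01 _ Hv z;
      by rewrite /mv_oplus; case: (leP (u z + v z)); lra.
  - by move=> B C BC [u Hu uB]; exists u => // k Hk uk; exact/BC/uB.
have [|h Hh hP] := Kc _ T (fun h z => h z = 1) TF.
  move=> y /Kh[h [Ah h0 h1]].
  (* Any [k] in the tail above [h] is squeezed between [h] and 1, so it equals 1 wherever [h]
     does. *)
  exists ([set z | h z = 1], [set k | H k /\ forall z, h z <= k z]) => /=.
    by split => //; exists h => // k Hk hk.
  move=> [z k]/= [hz [Hk hk]]; apply/eqP; rewrite eq_le.
  by rewrite -[X in _ && (X <= _)]hz hk andbT; have /andP[] := H01 _ Hk z.
(* The function [h] lies in its own tail, so it is itself 1 on all of [K]. *)
by have [Ah h0] := Hh; exists h; split=> // z Kz; exact: (hP h).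
Unshelve. all: by end_near. Qed.

Lemma delta_subalgebra_urysohn (R : realType) (X : topologicalType)
    (A : set (X -> R)) (K L : set X) : delta_subalgebra A -> separates A ->
  compact K -> compact L -> K `&` L = set0 ->
  exists h, [/\ A h, forall z, K z -> h z = 0 & forall z, L z -> h z = 1].
Proof.
move=> A_sub A_sep Kc Lc KL0.
have pts (x y : X) : x <> y -> exists h,
    [/\ A h, \forall z \near x, h z = 0 & \forall z \near y, h z = 1].
  move=> xy; have [f Af /eqP] := A_sep _ _ xy.
  rewrite neq_lt => /orP[|] fxy.
    exact: delta_subalgebra_sep_nbhs fxy.
  apply: (@delta_subalgebra_sep_nbhs _ _ _ (mv_neg f)) => //.
    exact: delta_subalgebra_neg.
  by rewrite /mv_neg; lra.
(* Two rounds of compactness: for fixed [y] in [L], covering [K] gives a function equal to 1 on [K]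
   and 0 near [y]; its negations for varying [y] are then combined over [L]. *)
apply: (@delta_subalgebra_sep_compact _ _ _ L (globally K)) => // y Ly.
have [|h [Ah h0 h1]] :=
    @delta_subalgebra_sep_compact _ _ A K (nbhs y) _ A_sub Kc.
  move=> x Kx; apply: pts => yx.
  by have : (K `&` L) x by [rewrite -yx in Kx *]; rewrite KL0.
exists (mv_neg h); split.
- exact: delta_subalgebra_neg.
- by move=> z Kz; rewrite /mv_neg h1// subrr.
- by near=> z; rewrite /mv_neg (near h0 z)// subr0.
Unshelve. all: by end_near. Qed.

Lemma delta_subalgebra_level (R : realType) (X : topologicalType)
    (A : set (X -> R)) (f : X -> R) (a b : R) :
  compact [set: X] -> delta_subalgebra A -> separates A -> continuous f ->
  a < b ->
  exists h, [/\ A h, forall z, f z <= a -> h z = 0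
                   & forall z, b <= f z -> h z = 1].
Proof.
move=> Xc A_sub A_sep fc ab.
apply: (@delta_subalgebra_urysohn _ _ _
  (f @^-1` [set t | t <= a]) (f @^-1` [set t | b <= t])) => //.
- apply: (subclosed_compact _ Xc) => //.
  by apply: closed_comp => [z _|]; [exact: fc | exact: closed_le].
- apply: (subclosed_compact _ Xc) => //.
  by apply: closed_comp => [z _|]; [exact: fc | exact: closed_ge].
- by apply/seteqP; split=> // z /= []; lra.
Qed.

Theorem theorem7p7 (R : realType) (X : topologicalType)
    (X_compact : compact [set: X]) (X_hausdorff : hausdorff_space X)
    (A : set (X -> R)) (A_sub : delta_subalgebra A) (A_sep : separates A) :
  A = CX R X.
Proof.
apply/seteqP; split; first exact: delta_subalgebra_sub.
apply: delta_subalgebra_coind => // [f []//|f [fc f01]].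
have lvl a b := @delta_subalgebra_level R X A f a b X_compact A_sub A_sep fc.
(* The digit must lie between [2 f - 1] and [2 f]. Where [f <= 1/2] it is [u / 2], at most 1/2 and
   zero once [f <= 1/4]; where [f > 1/2] it is [(1 + v) / 2], at least 1/2 and equal to 1 once
   [f >= 3/4]. *)
have [|u [Au u0 u1]] := lvl (1/4) (1/2); first lra.
have [|v [Av v0 v1]] := lvl (1/2) (3/4); first lra.
have Auv := delta_subalgebra_avg _ _ _ _ _ A_sub Au Av.
exists (fun x => (u x + v x) / 2) => //; split.
  have [uvc _] := delta_subalgebra_sub A_sub Auv.
  by move=> x; apply: cvgB; [apply: cvgM; [exact: cvg_cst | exact: fc]|exact: uvc].
move=> x; have := f01 x.
have := delta_subalgebra_01 _ _ _ A_sub _ Au x.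
have := delta_subalgebra_01 _ _ _ A_sub _ Av x.
have [fx|fx] := leP (f x) (1/2).
  by rewrite (v0 x fx); have [/[dup] ? /u0|?] := leP (f x) (1/4); lra.
rewrite (u1 x (ltW fx)).
by have [/[dup] ? /v1|?] := leP (3/4) (f x); lra.
Qed.
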